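(* Let $G$ and $H$ be finite simple graphs such that $G$ is a subgraph of $H$. If $G\in\mathcal{U}$, then $H\in\mathcal{U}$.
   Context: Let $V$ be a finite set of Boolean variables. A clause is a disjunction of literals from $V\cup\neg V\cup\{\top,\bot\}$; a CNF is a conjunction of clauses; it is reduced if unchanged under the rules $x\vee\top=\top$, $x\vee\bot=x$, $x\wedge\top=x$, $x\wedge\bot=\bot$, $x\vee x=x$, $x\wedge x=x$, $\neg\neg x=x$, $x\vee\neg x=\top$. A nontrivial reduced 2-CNF is a reduced CNF other than $\top,\bot$ all of whose clauses have exactly two literals. With $|x|=|\neg x|=x$, its associated multigraph has as vertices the variables occurring in it and one edge $\{|a|,|b|\}$ per clause $(a\vee b)$. The 2-CNF is simple if this multigraph has no multiple edges, in which case the graph is denoted $\mathcal{G}(S)$. $\mathcal{U}$ is the family of graphs $\mathcal{G}(S)$ with $S$ an unsatisfiable simple 2-CNF (unsatisfiable: no truth assignment makes it true).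
   Formalization: The graph H is additionally assumed to have no isolated vertex; without this the claim fails (G = K4, H = K4 plus an isolated vertex), since the vertices of G(S) are only the variables occurring in S. *)

(* Defs.v *)
From mathcomp Require Import all_boot.

Set Implicit Arguments.
Unset Strict Implicit.
Unset Printing Implicit Defensive.

Section TwoCNF.

Variable V : finType.

(* [inl (x, true)] is x, [inl (x, false)] is ~x, [inr true] is the constant
   top and [inr false] the constant bot.  Doubly negated literals do not exist
   in this syntax, so the rule ~~x = x has nothing to act on. *)
Definition literal : Type := (V * bool + bool)%type.

Definition pos (x : V) : literal := inl (x, true).
Definition neg (x : V) : literal := inl (x, false).
Definition top : literal := inr true.
Definition bot : literal := inr false.

(* Sequences stand for disjunctions, respectively conjunctions; repetitions
   are kept, and the order is irrelevant since the rewriting rules below are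
   applied up to permutation. *)
Definition clause : Type := seq literal.
Definition cnf : Type := seq clause.

Inductive clause_step (c : clause) : clause -> Prop :=
| or_top (l : literal) (d : clause) :
    perm_eq c [:: l, top & d] -> clause_step c (top :: d)
| or_bot (l : literal) (d : clause) :
    perm_eq c [:: l, bot & d] -> clause_step c (l :: d)
| or_idem (l : literal) (d : clause) :
    perm_eq c [:: l, l & d] -> clause_step c (l :: d)
| or_compl (x : V) (d : clause) :
    perm_eq c [:: pos x, neg x & d] -> clause_step c (top :: d).

Inductive cnf_step (S : cnf) : cnf -> Prop :=
| in_clause (c d : clause) (T : cnf) :
    perm_eq S (c :: T) -> clause_step c d -> cnf_step S (d :: T)
| and_top (c : clause) (T : cnf) :
    perm_eq S [:: c, [:: top] & T] -> cnf_step S (c :: T)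
| and_bot (c : clause) (T : cnf) :
    perm_eq S [:: c, [:: bot] & T] -> cnf_step S ([:: bot] :: T)
| and_idem (c c' : clause) (T : cnf) :
    perm_eq c c' -> perm_eq S [:: c, c' & T] -> cnf_step S (c :: T).

(* Every rule strictly decreases the size of the formula, so being unchanged
   under the rules means that none of them applies. *)
Definition reduced (S : cnf) : Prop := forall S' : cnf, ~ cnf_step S S'.

(* The constant formula top may also be written as the empty conjunction. *)
Definition nontrivial_reduced_2cnf (S : cnf) : Prop :=
  [/\ reduced S,
      S \notin [:: [::]; [:: [:: top]]; [:: [:: bot]]]
    & all (fun c => size c == 2) S].

Definition occurs (x : V) (c : clause) : bool := (pos x \in c) || (neg x \in c).

Definition variables (S : cnf) : {set V} := [set x | has (occurs x) S].

(* For a clause (a \/ b) of a reduced 2-CNF this is {|a|, |b|}. *)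
Definition clause_edge (c : clause) : {set V} := [set x | occurs x c].

Definition multigraph_edges (S : cnf) : seq {set V} := map clause_edge S.

Definition simple_2cnf (S : cnf) : Prop :=
  nontrivial_reduced_2cnf S /\ uniq (multigraph_edges S).

Definition eval_literal (f : V -> bool) (l : literal) : bool :=
  match l with
  | inl (x, b) => if b then f x else ~~ f x
  | inr b => b
  end.

Definition eval_cnf (f : V -> bool) (S : cnf) : bool :=
  all (has (eval_literal f)) S.

Definition unsatisfiable (S : cnf) : Prop :=
  forall f : V -> bool, ~~ eval_cnf f S.

(* A finite simple graph whose vertices form a subset of V. *)
Record sgraph : Type := SGraph {
  vertices : {set V};
  edges : {set {set V}};
  edgesP : forall e, e \in edges -> (#|e| == 2) && (e \subset vertices)
}.

Definition subgraph (G H : sgraph) : Prop :=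
  vertices G \subset vertices H /\ edges G \subset edges H.

Definition no_isolated_vertex (G : sgraph) : Prop :=
  forall x, x \in vertices G -> exists2 e, e \in edges G & x \in e.

(* G is the graph associated with the simple 2-CNF S. *)
Definition is_graph_of (S : cnf) (G : sgraph) : Prop :=
  vertices G = variables S /\ edges G = [set e in multigraph_edges S].

Definition in_U (G : sgraph) : Prop :=
  exists S : cnf, [/\ simple_2cnf S, unsatisfiable S & is_graph_of S G].

End TwoCNF.

(* Main.v *)
Require Import Defs.
From mathcomp Require Import all_boot.

(** A simple 2-CNF with graph [G] is extended by one clause of positive
    literals [x \/ y] for each edge [{x, y}] of [H] outside [G].  Adding clauses
    preserves unsatisfiability, and a 2-CNF whose clauses lie on pairwise
    distinct genuine edges admits no rewriting step. *)

Section TwoCNFGraph.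

Variable V : finType.
Implicit Types (S : cnf V) (c d : clause V) (l : literal V) (e : {set V}).

Lemma clause_edge_cons l c :
  clause_edge (l :: c) = clause_edge [:: l] :|: clause_edge c.
Proof. by apply/setP => x; rewrite !inE /occurs !inE orbACA. Qed.

Lemma perm_clause_edge {c d} : perm_eq c d -> clause_edge c = clause_edge d.
Proof.
by move=> /perm_mem eq_cd; apply/setP => x; rewrite !inE /occurs !eq_cd.
Qed.

Lemma clause_edge_literal (x : V) (b : bool) :
  clause_edge [:: inl (x, b)] = [set x].
Proof.
apply/setP => y; rewrite !inE /occurs !inE.
apply/orP/eqP => [[] /eqP[] //|->].
by case: b; [left|right].
Qed.

Lemma clause_edge_constant (b : bool) : clause_edge [:: inr b] = set0 :> {set V}.
Proof. by apply/setP => y; rewrite !inE /occurs !inE. Qed.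

Lemma card_clause_edge1 l : #|clause_edge [:: l]| <= 1.
Proof.
by case: l => [[x b]|b]; rewrite ?clause_edge_literal ?clause_edge_constant
  ?cards1 ?cards0.
Qed.

(** Every rule acts on two literals, one of which brings no variable beyond those of the other; a
    clause of size 2 has no further literal, so its edge degenerates. *)
Lemma clause_step_card_edge {c d} :
  clause_step c d -> size c = 2 -> #|clause_edge c| <= 1.
Proof.
have pair l1 l2 (d' : clause V) :
    clause_edge [:: l2] \subset clause_edge [:: l1] ->
    perm_eq c [:: l1, l2 & d'] -> size c = 2 -> #|clause_edge c| <= 1.
  move=> /setUidPl l21 pc; rewrite (perm_size pc) (perm_clause_edge pc) /=.
  case=> /size0nil ->; rewrite clause_edge_cons l21; exact: card_clause_edge1.
case=> [l d'|l d'|l d'|x d'] /pair; apply; rewrite ?clause_edge_constant ?sub0set //.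
by rewrite !clause_edge_literal.
Qed.

(** A step inside a clause would degenerate its edge, the rules for the constants need a clause of
    size 1, and idempotence of conjunction would repeat an edge. *)
Lemma reduced_uniq_edges S :
    all (fun c => size c == 2) S ->
    all (fun e => #|e| == 2) (multigraph_edges S) ->
    uniq (multigraph_edges S) ->
  reduced S.
Proof.
rewrite all_map => /allP size2 /allP card2 uniqS S'.
case=> [c d T pS step|c T pS|c T pS|c c' T pcc' pS].
- have cS : c \in S by rewrite (perm_mem pS) mem_head.
  have := clause_step_card_edge step (eqP (size2 _ cS)).
  by rewrite (eqP (card2 _ cS)).
- by have /size2 : [:: top V] \in S by rewrite (perm_mem pS) !inE eqxx orbT.
- by have /size2 : [:: bot V] \in S by rewrite (perm_mem pS) !inE eqxx orbT.
- move: uniqS; rewrite /multigraph_edges (perm_uniq (perm_map _ pS)) /=.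
  by rewrite (perm_clause_edge pcc') mem_head.
Qed.

Lemma in_variables S x :
  (x \in variables S) = has (fun e => x \in e) (multigraph_edges S).
Proof. by rewrite inE has_map; apply: eq_has => c; rewrite /= inE. Qed.

(** Any choice of signs would give the same edge. *)
Definition positive_clause e : clause V := [seq pos x | x <- enum e].

Lemma clause_edge_positive e : clause_edge (positive_clause e) = e.
Proof.
apply/setP => x; rewrite inE /occurs mem_map ?mem_enum; last by move=> y z [].
by apply/orb_idr => /mapP[y _].
Qed.

Lemma multigraph_edges_positive (s : seq {set V}) :
  multigraph_edges [seq positive_clause e | e <- s] = s.
Proof.
by rewrite /multigraph_edges -map_comp map_id_in // => e _;
  apply: clause_edge_positive.
Qed.

End TwoCNFGraph.

Arguments positive_clause {V} e.

(* The graph of a 2-CNF has only occurring variables as vertices, so a member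
   of the family never has isolated vertices: H is required to have none. *)
Theorem theorem5 (V : finType) (G H : sgraph V)
  (H_no_isolated : no_isolated_vertex H)
  (G_sub_H : subgraph G H) (G_in_U : in_U G) : in_U H.
Proof.
case: G_sub_H => _ /subsetP sGH.
case: G_in_U => S [[[_ ntS size2] uniqS] unsatS [_ EG]].
(* Edges of [G] already carry a clause of [S]; a second one would create a multiple edge. *)
pose new := enum (edges H :\: edges G).
pose S' := S ++ [seq positive_clause e | e <- new].
have edgesG e : (e \in multigraph_edges S) = (e \in edges G) by rewrite EG inE.
have meS' : multigraph_edges S' = multigraph_edges S ++ new.
  by rewrite /multigraph_edges map_cat -!/(multigraph_edges _)
    multigraph_edges_positive.
have edgesH e : (e \in multigraph_edges S') = (e \in edges H).
  rewrite meS' mem_cat edgesG mem_enum inE.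
  by case: (boolP (e \in edges G)) => [/sGH ->|].
have uniqS' : uniq (multigraph_edges S').
  rewrite meS' cat_uniq uniqS enum_uniq andbT.
  by apply/hasPn => e; rewrite mem_enum inE edgesG => /andP[].
have size2' : all (fun c => size c == 2) S'.
  rewrite all_cat size2 all_map; apply/allP => e; rewrite mem_enum inE.
  by case/andP=> _ /edgesP /andP[/eqP e2 _]; rewrite /= size_map -cardE e2.
exists S'; split.
- split=> //; split=> //.
  + apply: reduced_uniq_edges => //; apply/allP => e.
    by rewrite edgesH => /edgesP /andP[].
  (* The two constant formulas contain a clause of size 1, and an empty [S'] would force [S] to be
     empty. *)
  + rewrite !inE; apply/or3P; case=> /eqP S'E; move: size2'; rewrite S'E //.
    by move: ntS S'E; rewrite /S'; case: (S).
- move=> f; rewrite /eval_cnf all_cat negb_and; apply/orP; left; exact: unsatS.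
- split; apply/setP => x; last by rewrite inE edgesH.
  (* A vertex of [H] occurs in [S'] because it lies on an edge; conversely, edges of [H] join
     vertices of [H]. *)
  rewrite in_variables; apply/idP/hasP => [/H_no_isolated[e eH xe]|[e]].
    by exists e; rewrite ?edgesH.
  by rewrite edgesH => /edgesP /andP[_ /subsetP sub] /sub.
Qed.
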